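(* Let $A\in\mathbb{R}^{n\times n}$ be symmetric positive definite, let $G\in\mathbb{R}^{q\times n}$ have full row rank, and let $\{b_k\}_{k\in\mathbb{N}}\subset\mathbb{R}^n$ and $\{h_k\}_{k\in\mathbb{N}}\subset\mathbb{R}^q$ be sequences with rational $\mathcal{Z}$-transforms $$\mathcal{Z}[b_k]=\frac{b_{\mathrm N}(z)}{p(z)},\qquad \mathcal{Z}[h_k]=\frac{h_{\mathrm N}(z)}{p(z)},$$ where $b_{\mathrm N}(z)$, $h_{\mathrm N}(z)$ are vectors of real polynomials and $p(z)=z^m+\sum_{i=0}^{m-1}p_iz^i$ is a real monic polynomial of degree $m\ge 1$ all of whose complex zeros have modulus $1$. For each $k\in\mathbb{N}$ let $x_k^*$ be the unique solution of $$x_k^*=\operatorname*{arg\,min}_{x\in\mathbb{R}^n}\ \tfrac12 x^\top A x+b_k^\top x\quad\text{subject to } Gx=h_k .$$ Let $\tau$ satisfy $$0<\tau\le \frac{\lambda_{\min}(A)}{4\,\lambda_{\max}(GA^{-1}G^\top)},$$ and let $c(z)=\sum_{i=0}^{m-1}c_iz^i\in\mathbb{R}[z]$ be such that the matrix $F_c(\lambda)=F+\lambda CK$ (with $F,C,K$ as defined in the context from the coefficients of $p$ and $c$) has all its eigenvalues strictly inside the unit circle for every $$\lambda\in\left[\tau\,\lambda_{\min}(GA^{-1}G^\top),\ \lambda_{\max}(A)\right].$$ Let $\{x_k\}_{k\in\mathbb{N}}$ be the output of the online algorithm described in the context, run with these $F,C,K,\tau$ from any initial states $z_0\in\mathbb{R}^{nm}$,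 $y_0\in\mathbb{R}^{qm}$. Then $$\limsup_{k\to\infty}\|x_k-x_k^*\|=0 .$$
   Context: Notation: $\lambda_{\min}(\cdot)$ and $\lambda_{\max}(\cdot)$ are the minimum and maximum eigenvalues of a symmetric matrix; $\|\cdot\|$ is the Euclidean norm; $\otimes$ is the Kronecker product; $I_d$ is the $d\times d$ identity. The $\mathcal{Z}$-transform of a sequence $\{s_k\}_{k\in\mathbb{N}}$ (indexed from $k=0$) is $\mathcal{Z}[s_k]=\sum_{k\ge 0}s_kz^{-k}$, applied entrywise to vectors. The number of constraints is $q$ (not to be confused with the polynomial $p(z)$). Companion realization: given $p(z)=z^m+\sum_{i=0}^{m-1}p_iz^i$ and $c(z)=\sum_{i=0}^{m-1}c_iz^i$, let $F\in\mathbb{R}^{m\times m}$ be the companion matrix with ones on the first superdiagonal, last row $(-p_0,-p_1,\dots,-p_{m-1})$, and zeros elsewhere; let $C=(0,\dots,0,1)^\top\in\mathbb{R}^{m\times 1}$ and $K=(c_0,c_1,\dots,c_{m-1})\in\mathbb{R}^{1\times m}$. For $\lambda\in\mathbb{R}$, $F_c(\lambda)=F+\lambda CK$. Lagrangian: $\mathcal{L}_k(x,w)=\tfrac12x^\top Ax+b_k^\top x+w^\top(Gx-h_k)$ for $x\in\mathbb{R}^n$, $w\in\mathbb{R}^q$, so that $\nabla_x\mathcal{L}_k(x,w)=Ax+b_k+G^\top w$ and $\nabla_w\mathcal{L}_k(x,w)=Gx-h_k$. Online algorithm: the states are $z_k\in\mathbb{R}^{nm}$ and $y_k\in\mathbb{R}^{qm}$.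 For every $k\in\mathbb{N}$, $$x_k=(K\otimes I_n)z_k,\qquad w_k=-\tau(K\otimes I_q)y_k,$$ $$e_k=\nabla_x\mathcal{L}_k(x_k,w_k)=Ax_k+b_k+G^\top w_k,\qquad f_k=\nabla_w\mathcal{L}_k(x_k,w_k)=Gx_k-h_k,$$ $$z_{k+1}=(F\otimes I_n)z_k+(C\otimes I_n)e_k,\qquad y_{k+1}=(F\otimes I_q)y_k+(C\otimes I_q)f_k .$$ The output of the algorithm is the sequence $\{x_k\}_{k\in\mathbb{N}}$. *)

(* Defs.v *)
From HB Require Import structures.
From mathcomp Require Export all_boot all_order all_algebra.
From mathcomp Require Export all_classical all_reals all_analysis.
From mathcomp.real_closed Require Export complex mxtens.
From mathcomp Require Import ring.

Set Implicit Arguments.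
Unset Strict Implicit.
Unset Printing Implicit Defensive.

Import Order.TTheory GRing.Theory Num.Theory.
Import numFieldNormedType.Exports.

Local Open Scope classical_set_scope.
Local Open Scope ring_scope.
Local Open Scope complex_scope.

Section Matrices.
Context {R : realType}.

Definition posdefmx n (A : 'M[R]_n) : Prop :=
  A^T = A /\ forall x : 'cV[R]_n, x != 0 -> 0 < (x^T *m A *m x) 0 0.

(* The spectrum is a finite set, nonempty when A is symmetric of positive size,
   so that inf and sup are attained in that case. *)
Definition lambda_min n (A : 'M[R]_n) : R := inf [set a | eigenvalue A a].
Definition lambda_max n (A : 'M[R]_n) : R := sup [set a | eigenvalue A a].

(* The norm `|x| provided by the library on matrices is the sup norm. *)
Definition enorm n (x : 'cV[R]_n) : R := Num.sqrt (\sum_i x i 0 ^+ 2).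

(* Over R[i], x < y means that y - x is a positive real; in particular
   `|mu| < 1 is the usual comparison of moduli. *)
Definition schur_stable n (A : 'M[R]_n) : Prop :=
  forall mu : R[i], eigenvalue (map_mx (real_complex R) A) mu -> `|mu| < 1.

End Matrices.

(* The series defining the transform of s converges to f on the exterior of
   some disc; r is a positive real even when K is not ordered totally. *)
Definition has_ztransform (K : numFieldType) (s : nat -> K) (f : K -> K) : Prop :=
  exists2 r : K, 0 < r & forall z : K, r < `|z| ->
    series (fun k => s k * z ^- k) @ \oo --> f z.

Section RationalZTransform.
Context {R : realType}.

Definition ratfun (num den : {poly R}) (z : R[i]) : R[i] :=
  (map_poly (real_complex R) num).[z] / (map_poly (real_complex R) den).[z].

Definition has_rational_ztransform n (s : nat -> 'cV[R]_n)
    (num : 'cV[{poly R}]_n) (den : {poly R}) : Prop :=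
  forall i, @has_ztransform R[i] (fun k => (s k i 0)%:C) (ratfun (num i 0) den).

End RationalZTransform.

Section Realization.
Context {R : realType} (m : nat).

(* For p of size m.+1 this is companionmx p, with the dimension m kept as an
   independent index (see companion_FE). *)
Definition companion_F (p : {poly R}) : 'M[R]_m :=
  \matrix_(i < m, j < m)
    if (i == m.-1 :> nat) then - p`_j else (i.+1 == j :> nat)%:R.

Definition companion_C : 'cV[R]_m := \col_(i < m) (i == m.-1 :> nat)%:R.

Definition companion_K (c : {poly R}) : 'rV[R]_m := \row_(j < m) c`_j.

Definition companion_Fc (p c : {poly R}) (lam : R) : 'M[R]_m :=
  companion_F p + lam *: (companion_C *m companion_K c).

(* The casts identify 1 * d with d. *)
Definition F_kron d (p : {poly R}) : 'M[R]_(m * d) := companion_F p *t 1%:M.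
Definition C_kron d : 'M[R]_(m * d, d) :=
  castmx (erefl, mul1n d) (companion_C *t 1%:M).
Definition K_kron d (c : {poly R}) : 'M[R]_(d, m * d) :=
  castmx (mul1n d, erefl) (companion_K c *t 1%:M).

End Realization.

Lemma companion_FE {R : realType} (p : {poly R}) :
  companion_F (size p).-1 p = companionmx p.
Proof. by []. Qed.

Section Problem.
Context {R : realType} {n q : nat}.
Variables (A : 'M[R]_n) (b : nat -> 'cV[R]_n).
Variables (G : 'M[R]_(q, n)) (h : nat -> 'cV[R]_q).

Definition qcost (k : nat) (x : 'cV[R]_n) : R :=
  2^-1 * (x^T *m A *m x) 0 0 + ((b k)^T *m x) 0 0.

Definition is_argmin (k : nat) (x : 'cV[R]_n) : Prop :=
  G *m x = h k /\ forall x', G *m x' = h k -> qcost k x <= qcost k x'.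

Definition lagrangian (k : nat) (x : 'cV[R]_n) (w : 'cV[R]_q) : R :=
  qcost k x + (w^T *m (G *m x - h k)) 0 0.

(* The gradients of the Lagrangian, justified by lagrangianDx and lagrangianDw. *)
Definition grad_x (k : nat) (x : 'cV[R]_n) (w : 'cV[R]_q) : 'cV[R]_n :=
  A *m x + b k + G^T *m w.

Definition grad_w (k : nat) (x : 'cV[R]_n) (w : 'cV[R]_q) : 'cV[R]_q :=
  G *m x - h k.

Lemma lagrangianDx k x w d : A^T = A ->
  lagrangian k (x + d) w = lagrangian k x w
    + ((grad_x k x w)^T *m d) 0 0 + 2^-1 * (d^T *m A *m d) 0 0.
Proof.
move=> As; have dA : d^T *m A *m x = (x^T *m A *m d)^T.
  by rewrite !trmx_mul trmxK As mulmxA.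
rewrite /lagrangian /qcost /grad_x !linearD/= !trmx_mul trmxK As.
rewrite !(mulmxDl, mulmxDr) !mulmxA dA; move: (x^T *m A *m d) => M.
rewrite ![in LHS]mxE ![in RHS]mxE.
by field.
Qed.

Lemma lagrangianDw k x w d :
  lagrangian k x (w + d) = lagrangian k x w + ((grad_w k x w)^T *m d) 0 0.
Proof.
have -> : (grad_w k x w)^T *m d = (d^T *m (G *m x - h k))^T.
  by rewrite trmx_mul trmxK.
by rewrite /lagrangian [(w + d)^T]linearD/= mulmxDl !mxE addrA.
Qed.

End Problem.

Section Algorithm.
Context {R : realType} {n q : nat} (m : nat) (p c : {poly R}) (tau : R).
Variables (A : 'M[R]_n) (b : nat -> 'cV[R]_n).
Variables (G : 'M[R]_(q, n)) (h : nat -> 'cV[R]_q).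
Variables (z0 : 'cV[R]_(m * n)) (y0 : 'cV[R]_(m * q)).

Definition primal (z : 'cV[R]_(m * n)) : 'cV[R]_n := K_kron m n c *m z.
Definition dual (y : 'cV[R]_(m * q)) : 'cV[R]_q := - tau *: (K_kron m q c *m y).

Fixpoint alg_state (k : nat) : 'cV[R]_(m * n) * 'cV[R]_(m * q) :=
  if k is k'.+1 then
    let: (z, y) := alg_state k' in
    let x := primal z in
    let w := dual y in
    (F_kron m n p *m z + C_kron m n *m grad_x A b G k' x w,
     F_kron m q p *m y + C_kron m q *m grad_w G h k' x w)
  else (z0, y0).

Definition alg_output (k : nat) : 'cV[R]_n := primal (alg_state k).1.

End Algorithm.

(* Main.v *)
(** Put [w = -tau K y].  In controllable canonical form each state is the vector
    of successive shifts of one scalar sequence, so, with [sigma] the shift,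
    [p(sigma) x = c(sigma) e] and [p(sigma) w = - tau c(sigma) f].  The
    optimizer and its multiplier depend linearly on [b_k] and [h_k], hence from
    [k = 1] on they are annihilated by [p(sigma)], the denominator of the
    transforms.  The error [v = (x - xstar, w - wstar)] therefore satisfies
    [(p(sigma) I - c(sigma) M) v = 0] with the saddle matrix
    [M = [[A, G^T], [- tau G, 0]]], and multiplication by the adjugate gives
    the scalar recurrence [det (p I - c M)(sigma) v_i = 0].  The bound on [tau]
    makes every eigenvalue of [M] real and puts it in the interval of the
    stability hypothesis; a root [z] of [det (p I - c M)] is then a root of
    [p - lam c = char_poly (F_c lam)] for some [lam] in the interval, so
    [|z| < 1] and [v] tends to [0]. *)

Require Import Defs.
From mathcomp Require Import ring lra.

Set Implicit Arguments.
Unset Strict Implicit.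
Unset Printing Implicit Defensive.

Import Order.TTheory GRing.Theory Num.Theory.
Import numFieldNormedType.Exports.

Local Open Scope classical_set_scope.
Local Open Scope ring_scope.

(** * Polynomials in the shift *)

Section ShiftAction.
Context {K : comNzRingType}.

(** This is [p(sigma) s] at index [k], with [sigma] the shift; it makes sequences a module over
    [{poly K}]. *)
Definition shift_act (p : {poly K}) (s : nat -> K) (k : nat) : K :=
  \sum_(i < size p) p`_i * s (k + i)%N.

Lemma shift_act_wide N (p : {poly K}) s k : (size p <= N)%N ->
  shift_act p s k = \sum_(i < N) p`_i * s (k + i)%N.
Proof.
move=> pN; rewrite /shift_act (big_ord_widen _ (fun i => p`_i * s (k + i)%N) pN).
rewrite big_mkcond; apply: eq_bigr => i _.
by case: ltnP => // ip; rewrite nth_default ?mul0r.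
Qed.

Lemma eq_shift_act (p : {poly K}) s t k : (forall j, (k <= j)%N -> s j = t j) ->
  shift_act p s k = shift_act p t k.
Proof. by move=> st; apply: eq_bigr => i _; rewrite st ?leq_addr. Qed.

Lemma shift_actD (p r : {poly K}) s k :
  shift_act (p + r) s k = shift_act p s k + shift_act r s k.
Proof.
have [leN leM] := (leq_maxl (size p) (size r), leq_maxr (size p) (size r)).
rewrite !(@shift_act_wide (maxn (size p) (size r))) ?size_polyD //.
by rewrite -big_split; apply: eq_bigr => i _; rewrite coefD mulrDl.
Qed.

Lemma shift_act0 s k : shift_act 0 s k = 0.
Proof. by rewrite /shift_act size_poly0 big_ord0. Qed.

Lemma shift_act_sum I r (P : pred I) (F : I -> {poly K}) s k :
  shift_act (\sum_(i <- r | P i) F i) s k = \sum_(i <- r | P i) shift_act (F i) s k.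
Proof.
apply: (big_morph (fun p => shift_act p s k)) => [p t|]; last exact: shift_act0.
exact: shift_actD.
Qed.

Lemma shift_act_linr (p : {poly K}) I (r : seq I) (a : I -> K) (s : I -> nat -> K) k :
  shift_act p (fun j => \sum_(i <- r) a i * s i j) k =
    \sum_(i <- r) a i * shift_act p (s i) k.
Proof.
rewrite /shift_act; under eq_bigr => i _ do rewrite mulr_sumr.
rewrite exchange_big; apply: eq_bigr => i _ /=; rewrite mulr_sumr.
by apply: eq_bigr => j _; rewrite mulrCA.
Qed.

Lemma shift_act_sumr (p : {poly K}) I (r : seq I) (s : I -> nat -> K) k :
  shift_act p (fun j => \sum_(i <- r) s i j) k = \sum_(i <- r) shift_act p (s i) k.
Proof.
rewrite /shift_act exchange_big; apply: eq_bigr => i _ /=.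
by rewrite mulr_sumr.
Qed.

Lemma shift_actDr (p : {poly K}) s t k :
  shift_act p (fun j => s j + t j) k = shift_act p s k + shift_act p t k.
Proof. by rewrite /shift_act -big_split; apply: eq_bigr => i _; rewrite mulrDr. Qed.

Lemma shift_actZr (p : {poly K}) a s k :
  shift_act p (fun j => a * s j) k = a * shift_act p s k.
Proof. by rewrite /shift_act mulr_sumr; apply: eq_bigr => i _; rewrite mulrCA. Qed.

Lemma shift_actNr (p : {poly K}) s k :
  shift_act p (fun j => - s j) k = - shift_act p s k.
Proof. by rewrite /shift_act -sumrN; apply: eq_bigr => i _; rewrite mulrN. Qed.

Lemma shift_act_MXaddC (p : {poly K}) c s k :
  shift_act (p * 'X + c%:P) s k = c * s k + shift_act p s k.+1.
Proof.
rewrite (@shift_act_wide (size p).+1); last first.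
  by rewrite size_MXaddC; case: ifP.
rewrite big_ord_recl /= coefD coefMX coefC eqxx add0r addn0; congr (_ + _).
by apply: eq_bigr => i _; rewrite coefD coefMX coefC /= addr0 addnS.
Qed.

Lemma shift_actZ a (p : {poly K}) s k : shift_act (a *: p) s k = a * shift_act p s k.
Proof.
rewrite (@shift_act_wide (size p)) ?size_scale_leq // mulr_sumr.
by apply: eq_bigr => i _; rewrite coefZ mulrA.
Qed.

Lemma shift_actM (p r : {poly K}) s k :
  shift_act (p * r) s k = shift_act p (shift_act r s) k.
Proof.
elim/poly_ind: p s k => [|p c IHp] s k; first by rewrite mul0r !shift_act0.
rewrite shift_act_MXaddC mulrDl mul_polyC mulrAC shift_actD shift_actZ addrC -IHp.
by rewrite -(addr0 (p * r * 'X)) -polyC0 shift_act_MXaddC mul0r add0r.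
Qed.

Lemma shift_actMC (p r : {poly K}) s k :
  shift_act p (shift_act r s) k = shift_act r (shift_act p s) k.
Proof. by rewrite -!shift_actM mulrC. Qed.

Lemma shift_act_succ (p : {poly K}) s k :
  shift_act p (fun j => s j.+1) k = shift_act p s k.+1.
Proof. by apply: eq_bigr => i _; rewrite addSn. Qed.

(** Multiplying the system by the adjugate decouples it, since [\adj P *m P] is [\det P] times the
    identity. *)
Lemma shift_act_det N (P : 'M[{poly K}]_N) (v : 'I_N -> nat -> K) :
  (forall i k, \sum_j shift_act (P i j) (v j) k = 0) ->
  forall l k, shift_act (\det P) (v l) k = 0.
Proof.
move=> Pv l k.
have -> : shift_act (\det P) (v l) k = \sum_j shift_act ((\adj P *m P) l j) (v j) k.
  rewrite mul_adj_mx (bigD1 l) //= mxE eqxx mulr1n big1 ?addr0 // => j jl.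
  by rewrite mxE eq_sym (negPf jl) mulr0n shift_act0.
under eq_bigr => j _ do rewrite mxE shift_act_sum.
rewrite exchange_big big1 //= => i _.
under eq_bigr => j _ do rewrite shift_actM.
rewrite -shift_act_sumr /shift_act big1 // => t _.
by rewrite Pv mulr0.
Qed.

End ShiftAction.

Lemma shift_act_map (K L : comNzRingType) (f : {rmorphism K -> L}) (p : {poly K}) s k :
  shift_act (map_poly f p) (f \o s) k = f (shift_act p s k).
Proof.
rewrite (@shift_act_wide _ (size p)) ?size_poly // rmorph_sum.
by apply: eq_bigr => i _; rewrite coef_map rmorphM.
Qed.

(** * Decay of stable scalar recurrences *)

Section StableRecurrence.
Context {R : realType}.

Lemma cvg0_affine_recursion (rho : R) (a t : nat -> R) : 0 <= rho < 1 ->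
  (forall k, 0 <= a k) -> (forall k, a k.+1 <= rho * a k + t k) ->
  t @ \oo --> 0 -> a @ \oo --> 0.
Proof.
move=> /andP[rho0 rho1] a0 at_ t0.
have r1 : 0 < 1 - rho by rewrite subr_gt0.
apply/cvgrPdist_lt => e e0.
(* This threshold for [t] makes [e / 2] the fixed point of the map sending [a] to
   [rho * a + (1 - rho) * (e / 2)]. *)
have d0 : 0 < (1 - rho) * (e / 2) by rewrite mulr_gt0 // divr_gt0.
have [N _ tN] := (cvgrPdist_lt _ _).1 t0 _ d0.
have aN k : a (N + k)%N <= rho ^+ k * a N + e / 2.
  elim: k => [|k IH]; first by rewrite addn0 expr0 mul1r lerDl ltW // divr_gt0.
  rewrite addnS (le_trans (at_ _)) //.
  have := tN (N + k)%N (leq_addr _ _); rewrite sub0r normrN => /ltr_normlW tk.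
  have := ler_wpM2l rho0 IH; rewrite mulrDr mulrA -exprS => IH'.
  by move: IH' tk; lra.
have /cvgrPdist_lt : (fun k => a N * rho ^+ k) @ \oo --> a N * 0.
  by apply: cvgMr; apply: cvg_expr; rewrite ger0_norm.
rewrite mulr0 => /(_ (e / 2)) []; first by rewrite divr_gt0.
move=> M _ hM; exists (N + M)%N => // k /= NMk.
have Nk : (N <= k)%N by rewrite (leq_trans (leq_addr _ _) NMk).
rewrite sub0r normrN ger0_norm //.
have := hM (k - N)%N; rewrite /= leq_subRL // => /(_ NMk).
rewrite sub0r normrN => /ltr_normlW; have := aN (k - N)%N; rewrite subnKC //.
by rewrite mulrC; lra.
Qed.

Lemma complex_norm_lt1 (x : R[i]) : (`|x| < 1 :> R[i]) = (Normc.normc x < 1).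
Proof. by rewrite -ltcR. Qed.

(** Induction on the roots: ['X - r%:P] applied to [s] is annihilated by the remaining factors,
    hence tends to 0, and [s k.+1] is [r * s k] plus this vanishing term. *)
Lemma normc_shift_linear_factors (rs : seq R[i]) (s : nat -> R[i]) :
  (forall r, r \in rs -> `|r| < 1) ->
  (forall k, shift_act (\prod_(r <- rs) ('X - r%:P)) s k = 0) ->
  (fun k => Normc.normc (s k)) @ \oo --> (0 : R).
Proof.
have [N] := ubnP (size rs); elim: N rs s => // N IH [|r rs] /=.
  move=> s _ _ s0; suff -> : (fun k => Normc.normc (s k)) = cst 0 by exact: cvg_cst.
  apply/funext => k; have := s0 k; rewrite big_nil /shift_act size_poly1 big_ord1.
  by rewrite coef1 mul1r addn0 => ->; rewrite Normc.normc0.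
move=> s; rewrite ltnS => szN rs1 s0.
have r1 : Normc.normc r < 1 by rewrite -complex_norm_lt1 rs1 ?mem_head.
have XrE t k : shift_act ('X - r%:P) t k = t k.+1 - r * t k.
  rewrite -polyCN -['X]mul1r shift_act_MXaddC /shift_act size_poly1 big_ord1.
  by rewrite coef1 mul1r addn0 mulNr addrC.
have t0 : (fun k => Normc.normc (shift_act ('X - r%:P) s k)) @ \oo --> (0 : R).
  apply: (IH rs) => // [r' r'rs|k]; first by rewrite rs1 // in_cons r'rs orbT.
  by rewrite -shift_actM mulrC; have := s0 k; rewrite big_cons.
apply: (@cvg0_affine_recursion (Normc.normc r)) t0.
- by rewrite r1 andbT; case: (r) => x y; rewrite sqrtr_ge0.
- by move=> k; rewrite /=; case: (s k) => x y; rewrite sqrtr_ge0.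
- move=> k /=; rewrite -Normc.normcM XrE.
  by have := le_normcD (r * s k) (s k.+1 - r * s k); rewrite addrC subrK.
Qed.

End StableRecurrence.

Lemma cvg0_stable_recurrence (R : realType) (D : {poly R}) (s : nat -> R) :
  (forall z : R[i], root (map_poly (real_complex R) D) z -> `|z| < 1) ->
  (forall k, shift_act D s k = 0) -> s @ \oo --> (0 : R).
Proof.
move=> Droots Ds; pose DC := map_poly (real_complex R) D.
(* [D = 0] would have the root [1]. *)
have DC0 : lead_coef DC != 0.
  rewrite lead_coef_eq0; apply/eqP => DC0; have := Droots 1.
  by rewrite -/DC DC0 root0 normr1 ltxx => /(_ isT).
have [rs Drs] := closed_field_poly_normal DC.
have sC : (fun k => Normc.normc ((real_complex R \o s) k)) @ \oo --> (0 : R).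
  apply: (@normc_shift_linear_factors _ rs) => [r r_rs|k].
    by apply: Droots; rewrite -/DC Drs rootZ // root_prod_XsubC.
  by apply: (mulfI DC0); rewrite -shift_actZ -Drs shift_act_map Ds mulr0.
apply: norm_cvg0; apply: cvg_trans sC.
suff -> : (fun k => Normc.normc ((real_complex R \o s) k)) = (fun k => `|s k|) by [].
by apply/funext => k /=; rewrite expr0n /= addr0 sqrtr_sqr.
Qed.

(** * Rayleigh bounds *)

Section Rayleigh.
Context {R : realType}.
Local Notation toC := (real_complex R).
Local Open Scope sesquilinear_scope.

Lemma conjC_real_complex (a : R) : (toC a)^* = toC a.
Proof. by apply: CrealP; apply/complex_realP; exists a. Qed.

Lemma norm_complexE (z : R[i]) : `|z| = toC (Normc.normc z).
Proof. by case: z. Qed.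

Lemma conjC_mul_self (z : R[i]) : z^* * z = toC (Normc.normc z ^+ 2).
Proof. by rewrite mulrC -normCK rmorphXn norm_complexE. Qed.

(** The matrix is diagonalized over [R[i]] by a unitary [P]; the weights [y i] are the squared
    moduli of the coordinates of [P x], which brings the statement back to [R]. *)
Lemma sym_spectral_decomposition n (A : 'M[R]_n) : A^T = A ->
  exists d : 'I_n -> R, (forall i, eigenvalue A (d i)) /\
  forall x : 'cV[R]_n, exists y : 'I_n -> R, [/\ forall i, 0 <= y i,
    (x^T *m A *m x) 0 0 = \sum_i d i * y i & (x^T *m x) 0 0 = \sum_i y i].
Proof.
move=> As; pose AC := map_mx toC A.
have ACherm : AC \is hermsymmx.
  apply: realsym_hermsym.
    apply/is_hermitianmxP; rewrite expr0 scale1r.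
    by apply/matrixP => i j; rewrite !mxE -[in LHS]As mxE.
  by apply/mxOverP => i j; rewrite mxE; apply/complex_realP; exists (A i j).
pose P := spectralmx AC; pose D := spectral_diag AC.
have AE : AC = invmx P *m diag_mx D *m P.
  exact/orthomx_spectralP/hermitian_normalmx.
have Pu : P \is unitarymx := spectral_unitarymx AC.
have Dr i : D 0 i = toC (complex.Re (D 0 i)).
  by rewrite RRe_real //; exact: (mxOverP (hermitian_spectral_diag_real ACherm)).
exists (fun i => complex.Re (D 0 i)); split=> [i|x].
  rewrite -(eigenvalue_map toC) /= -Dr; apply/eigenvalueP; exists (row i P).
    rewrite -row_mul -/AC AE mulmxA mulKVmx ?mulVmx ?spectral_unit //.
    by apply/rowP => j; rewrite row_mul row_diag_mx -scalemxAl -rowE !mxE.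
  apply/eqP => Pi0; have := spectral_unit AC; rewrite -row_free_unit.
  move=> /row_freeP[B /(congr1 (row i))]; rewrite row_mul Pi0 mul0mx row1.
  by move=> /rowP/(_ i)/eqP; rewrite !mxE !eqxx eq_sym oner_eq0.
pose xC := map_mx toC x; pose y := P *m xC.
have xCt : map_mx toC x^T = xC^t*.
  by apply/matrixP => i j; rewrite !mxE conjC_real_complex.
have yt : y^t* = xC^t* *m invmx P.
  by rewrite trmx_mul map_mxM invmx_unitary.
have sqE i : y^t* 0 i * y i 0 = toC (Normc.normc (y i 0) ^+ 2).
  by rewrite 2!mxE conjC_mul_self.
exists (fun i => Normc.normc (y i 0) ^+ 2); split=> [i||]; first exact: sqr_ge0.
  apply: (@complexI R).
  have -> : toC ((x^T *m A *m x) 0 0) = (xC^t* *m AC *m xC) 0 0.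
    by rewrite -xCt -!map_mxM [RHS]mxE.
  rewrite AE !mulmxA -yt -mulmxA -/y rmorph_sum mxE; apply: eq_bigr => i _.
  rewrite mul_mx_diag mxE mulrAC sqE [RHS]rmorphM mulrC; congr (_ * _); exact: Dr.
apply: (@complexI R).
have -> : toC ((x^T *m x) 0 0) = (xC^t* *m xC) 0 0 by rewrite -xCt -map_mxM [RHS]mxE.
have -> : xC^t* *m xC = y^t* *m y by rewrite yt mulmxA mulmxKV ?spectral_unit.
by rewrite rmorph_sum mxE; apply: eq_bigr => i _; exact: sqE.
Qed.

Lemma dot_self_gt0 n (x : 'cV[R]_n) : x != 0 -> 0 < (x^T *m x) 0 0.
Proof.
move=> x0; have [i xi] : exists i, x i 0 != 0.
  apply/existsP; apply: contraR x0; rewrite negb_exists => /forallP x0.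
  by apply/eqP/colP => i; rewrite mxE; apply/eqP; have := x0 i; rewrite negbK.
rewrite mxE (bigD1 i) //= mxE -expr2 ltr_pwDl ?exprn_even_gt0 //.
by apply: sumr_ge0 => j _; rewrite mxE -expr2 sqr_ge0.
Qed.

Lemma dot_self_ge0 n (x : 'cV[R]_n) : 0 <= (x^T *m x) 0 0.
Proof. by rewrite mxE sumr_ge0 // => j _; rewrite mxE -expr2 sqr_ge0. Qed.

(** Boundedness of the spectrum is what lets the infimum [lambda_min] and the supremum [lambda_max]
    bound the eigenvalues. *)
Lemma sym_eigenvalue_bounded n (A : 'M[R]_n) : A^T = A ->
  exists B, forall a, eigenvalue A a -> `|a| <= B.
Proof.
move=> As; have [d [_ dP]] := sym_spectral_decomposition As.
exists (\sum_i `|d i|) => a /eigenvalueP[v vA v0].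
have vT0 : v^T != 0 by rewrite -(inj_eq (@trmx_inj _ _ _)) trmxK trmx0.
have [y [y0 yA yx]] := dP v^T; have v_gt0 := dot_self_gt0 vT0.
rewrite -(ler_pM2r v_gt0).
have -> : `|a| * (v^T^T *m v^T) 0 0 = `|(v^T^T *m A *m v^T) 0 0|.
  rewrite [in RHS]trmxK vA -scalemxAl [in RHS]mxE normrM; congr (_ * _).
  by move: v_gt0; rewrite trmxK => /ltW/ger0_norm.
rewrite yA yx mulr_suml (le_trans (ler_norm_sum _ _ _)) // ler_sum // => i _.
rewrite normrM ler_wpM2l // ger0_norm // (bigD1 i) //= lerDl.
by apply: sumr_ge0.
Qed.

Lemma lambda_min_le n (A : 'M[R]_n) a : A^T = A -> eigenvalue A a -> lambda_min A <= a.
Proof.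
move=> /sym_eigenvalue_bounded[B HB] Aa; apply: ge_inf => //.
by exists (- B) => c /= /HB /ler_normlP[]; lra.
Qed.

Lemma lambda_max_ge n (A : 'M[R]_n) a : A^T = A -> eigenvalue A a -> a <= lambda_max A.
Proof.
move=> /sym_eigenvalue_bounded[B HB] Aa; apply: ub_le_sup => //.
by exists B => c /= /HB /ler_normlP[].
Qed.

Lemma rayleigh_bounds n (A : 'M[R]_n) (x : 'cV[R]_n) : A^T = A ->
  lambda_min A * (x^T *m x) 0 0 <= (x^T *m A *m x) 0 0
    <= lambda_max A * (x^T *m x) 0 0.
Proof.
move=> As; have [d [dA /(_ x)[y [y0 -> ->]]]] := sym_spectral_decomposition As.
rewrite !mulr_sumr; apply/andP; split; apply: ler_sum => i _; rewrite ler_wpM2r //.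
  exact: lambda_min_le.
exact: lambda_max_ge.
Qed.

End Rayleigh.

(** * Saddle-point matrices *)

Section DotProduct.
Context {R : realType}.

Definition dot n (x y : 'cV[R]_n) : R := (x^T *m y) 0 0.

Lemma dotC n (x y : 'cV[R]_n) : dot x y = dot y x.
Proof. by rewrite /dot !mxE; apply: eq_bigr => i _; rewrite !mxE mulrC. Qed.

Lemma dotDr n (x y z : 'cV[R]_n) : dot x (y + z) = dot x y + dot x z.
Proof. by rewrite /dot mulmxDr mxE. Qed.

Lemma dotDl n (x y z : 'cV[R]_n) : dot (y + z) x = dot y x + dot z x.
Proof. by rewrite dotC dotDr !(dotC x). Qed.

Lemma dotZr n a (x y : 'cV[R]_n) : dot x (a *: y) = a * dot x y.
Proof. by rewrite /dot -scalemxAr mxE. Qed.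

Lemma dotZl n a (x y : 'cV[R]_n) : dot (a *: x) y = a * dot x y.
Proof. by rewrite dotC dotZr dotC. Qed.

Lemma dotNr n (x y : 'cV[R]_n) : dot x (- y) = - dot x y.
Proof. by rewrite -scaleN1r dotZr mulN1r. Qed.

Lemma dotNl n (x y : 'cV[R]_n) : dot (- x) y = - dot x y.
Proof. by rewrite dotC dotNr dotC. Qed.

Definition dotE := (dotDr, dotDl, dotNr, dotNl, dotZr, dotZl).

Lemma dot_mulmx m n (B : 'M[R]_(m, n)) x y : dot x (B *m y) = dot (B^T *m x) y.
Proof. by rewrite /dot trmx_mul trmxK mulmxA. Qed.

Lemma dot_ge0 n (x : 'cV[R]_n) : 0 <= dot x x.
Proof. exact: dot_self_ge0. Qed.

Lemma dot_gt0 n (x : 'cV[R]_n) : (0 < dot x x) = (x != 0).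
Proof.
apply/idP/idP => [|/dot_self_gt0//]; apply: contraTneq => ->.
by rewrite /dot mulmx0 mxE ltxx.
Qed.

Lemma rayleigh_dot n (A : 'M[R]_n) (x : 'cV[R]_n) : A^T = A ->
  lambda_min A * dot x x <= dot x (A *m x) <= lambda_max A * dot x x.
Proof. by move=> As; rewrite /dot mulmxA; exact: rayleigh_bounds. Qed.

End DotProduct.

Section SaddlePoint.
Context {R : realType} {n q : nat}.
Variables (A : 'M[R]_n) (G : 'M[R]_(q, n)).
Hypotheses (n_gt0 : (0 < n)%N) (q_gt0 : (0 < q)%N).
Hypotheses (Apos : posdefmx A) (Gfree : row_free G).

(** Up to sign, the Schur complement of [A] in the KKT matrix [[[A, G^T], [G, 0]]]. *)
Let S := G *m invmx A *m G^T.

Lemma posdefmx_sym : A^T = A. Proof. by case: Apos. Qed.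

Lemma posdefmx_dot (x : 'cV[R]_n) : x != 0 -> 0 < dot x (A *m x).
Proof. by move=> /(proj2 Apos); rewrite /dot mulmxA. Qed.

Lemma posdefmx_dot_ge0 (x : 'cV[R]_n) : 0 <= dot x (A *m x).
Proof.
by have [->|/posdefmx_dot/ltW//] := eqVneq x 0; rewrite /dot mulmx0 mulmx0 mxE.
Qed.

Lemma posdefmx_unit : A \in unitmx.
Proof.
rewrite -row_free_unit -kermx_eq0; apply/rowV0P => v /sub_kermxP vA.
apply/eqP; apply: contraT => v0.
have : 0 < dot v^T (A *m v^T).
  by apply: posdefmx_dot; rewrite -(inj_eq (@trmx_inj _ _ _)) trmxK trmx0.
by rewrite /dot trmxK mulmxA vA mul0mx mxE ltxx.
Qed.

Lemma trmx_free_inj (w : 'cV[R]_q) : G^T *m w = 0 -> w = 0.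
Proof.
move=> Gw; apply: trmx_inj; apply: (row_free_inj Gfree).
by rewrite trmx0 mul0mx -[G]trmxK -trmx_mul Gw trmx0.
Qed.

Lemma schur_sym : S^T = S.
Proof. by rewrite /S !trmx_mul trmxK trmx_inv posdefmx_sym mulmxA. Qed.

Lemma schur_dot (w : 'cV[R]_q) (v := invmx A *m (G^T *m w)) :
  dot w (S *m w) = dot v (A *m v).
Proof.
rewrite /v mulKVmx ?posdefmx_unit // [RHS]dot_mulmx trmxK [RHS]dotC.
by rewrite /S !mulmxA.
Qed.

Lemma schur_posdef (w : 'cV[R]_q) : w != 0 -> 0 < dot w (S *m w).
Proof.
move=> w0; rewrite schur_dot posdefmx_dot //; apply: contra_neq w0 => v0.
by apply: trmx_free_inj; rewrite -[LHS](mulKVmx posdefmx_unit) v0 mulmx0.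
Qed.

Lemma lambda_max_schur_gt0 : 0 < lambda_max S.
Proof.
(* Positive dimension supplies a nonzero test vector for the Rayleigh bound. *)
have w0 : (const_mx 1 : 'cV[R]_q) != 0.
  by apply/eqP => /colP/(_ (Ordinal q_gt0))/eqP; rewrite !mxE oner_eq0.
have /andP[_ h] := rayleigh_dot (const_mx 1) schur_sym.
by have := lt_le_trans (schur_posdef w0) h; rewrite pmulr_lgt0 // dot_gt0.
Qed.

Lemma lambda_min_le_max m (B : 'M[R]_m) : (0 < m)%N -> B^T = B ->
  lambda_min B <= lambda_max B.
Proof.
move=> m_gt0 Bs; have w0 : (const_mx 1 : 'cV[R]_m) != 0.
  by apply/eqP => /colP/(_ (Ordinal m_gt0))/eqP; rewrite !mxE oner_eq0.
have /andP[h1 h2] := rayleigh_dot (const_mx 1) Bs.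
by have := le_trans h1 h2; rewrite ler_pM2r // dot_gt0.
Qed.

Lemma dot_mulmx_le_schur (x : 'cV[R]_n) :
  dot (G *m x) (G *m x) <= lambda_max S * dot x (A *m x).
Proof.
(* Positivity of [A] at [lambda_max S *: x - A^-1 G^T G x]. *)
set y := G *m x; set v := invmx A *m (G^T *m y); have L0 := lambda_max_schur_gt0.
have Av : A *m v = G^T *m y by rewrite mulKVmx ?posdefmx_unit.
have := posdefmx_dot_ge0 (lambda_max S *: x - v).
rewrite mulmxBr -scalemxAr !dotE.
have xv : dot x (A *m v) = dot y y by rewrite Av dot_mulmx trmxK.
have vx : dot v (A *m x) = dot y y by rewrite dot_mulmx posdefmx_sym dotC.
rewrite xv vx; have := schur_dot y; rewrite -/v => <-.
have /andP[_] := rayleigh_dot y schur_sym.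
set a := dot x (A *m x); set s := dot y (S *m y); set L := lambda_max S in L0 *.
move=> h1 h2; have : 0 <= L * (L * a - dot y y) by move: h1 h2; lra.
by rewrite pmulr_rge0 // subr_ge0.
Qed.

Variable tau : R.
Hypotheses (tau_gt0 : 0 < tau).
Hypothesis tau_le : tau <= lambda_min A / (4 * lambda_max S).

Lemma tau_schur_le : 4 * tau * lambda_max S <= lambda_min A.
Proof.
have L0 : 0 < 4 * lambda_max S by rewrite mulr_gt0 // lambda_max_schur_gt0.
by move: tau_le; rewrite ler_pdivlMr //; lra.
Qed.

(** Provides a value of [lam] for the degenerate case where [p] and [c] vanish together. *)
Lemma tau_interval_nonempty : tau * lambda_min S <= lambda_max A.
Proof.
have := tau_schur_le; have := lambda_min_le_max n_gt0 posdefmx_sym.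
have := ler_wpM2l (ltW tau_gt0) (lambda_min_le_max q_gt0 schur_sym).
have := mulr_gt0 tau_gt0 lambda_max_schur_gt0; lra.
Qed.

(** Pairing the two rows with [x] and [w] and eliminating the cross term [<w, G x>] gives the
    identity [key], from which [al > 0] and the upper bound follow. The lower bound is by
    contradiction, through [S] at [w]. *)
Lemma saddle_real_eigenvalue_bounds (al : R) (x : 'cV[R]_n) (w : 'cV[R]_q) :
  x != 0 -> A *m x + G^T *m w = al *: x -> - tau *: (G *m x) = al *: w ->
  tau * lambda_min S <= al <= lambda_max A.
Proof.
move=> x0 e1 e2; have X0 : 0 < dot x x by rewrite dot_gt0.
have a0 := posdefmx_dot x0; have W0 := dot_ge0 w.
have /andP[aA1 aA2] := rayleigh_dot x posdefmx_sym.
have f1 := congr1 (dot x) e1; have f2 := congr1 (dot w) e2.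
have gE : dot x (G^T *m w) = dot w (G *m x) by rewrite dot_mulmx trmxK dotC.
rewrite !dotE gE in f1 f2.
have key : tau * dot x (A *m x) = al * (tau * dot x x + dot w w).
  by rewrite mulrDr -f2 (mulrCA al) -f1; ring.
have al0 : 0 < al.
  have := mulr_gt0 tau_gt0 a0; rewrite key pmulr_lgt0 //.
  by rewrite ltr_pwDl // mulr_gt0.
apply/andP; split; last first.
  rewrite -(ler_pM2r X0); apply: le_trans aA2.
  rewrite -(ler_pM2l tau_gt0) key.
  by have := mulr_ge0 (ltW al0) W0; lra.
rewrite leNgt; apply/negP => al_lt.
(* With [u = A^-1 x] and [v = A^-1 G^T w = al u - x], the value of [S] at [w] is
   [al |w|^2 / tau + al <x, v>], and [<x, v> <= 0] because [al < lambda_min A]. *)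
have alA : al < lambda_min A.
  have := tau_schur_le; have := mulr_gt0 tau_gt0 lambda_max_schur_gt0.
  have := ler_wpM2l (ltW tau_gt0) (lambda_min_le_max q_gt0 schur_sym).
  by move: al_lt; lra.
(* If [w = 0], then [al] is the Rayleigh quotient of [A] at [x], contradicting
   [al < lambda_min A]. *)
have Wgt0 : 0 < dot w w.
  rewrite dot_gt0; apply/eqP => w0; move: f1.
  rewrite w0 [dot 0 _]/dot trmx0 mul0mx mxE addr0 => ax.
  by move: aA1; rewrite ax ler_pM2r // leNgt alA.
set u := invmx A *m x; have Au : A *m u = x by rewrite mulKVmx ?posdefmx_unit.
set v := invmx A *m (G^T *m w).
have Av : A *m v = G^T *m w by rewrite mulKVmx ?posdefmx_unit.
have vE : v = al *: u - x.
  by rewrite -[RHS](mulKmx posdefmx_unit) mulmxBr -scalemxAr Au -e1 addrAC subrr add0r.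
have /andP[Sw _] := rayleigh_dot w schur_sym.
have sE : dot w (S *m w) = al * dot x v + al * dot w w / tau.
  rewrite schur_dot -/v Av {1}vE !dotE gE -Av dot_mulmx posdefmx_sym Au -f2.
  by field; rewrite gt_eqF.
(* Expand [|x - al u|^2 >= 0] and use [al |u|^2 <= <x, u>], the Rayleigh bound at [u]. *)
have xv : dot x v <= 0.
  rewrite vE !dotE; have := dot_ge0 (A *m u - al *: u).
  have /andP[uA _] := rayleigh_dot u posdefmx_sym; move: uA.
  rewrite Au !dotE (dotC u x).
  have U0 := dot_ge0 u; have := mulr_ge0 (ltW al0) U0.
  move=> _ uA h; have : al * (al * dot u u) <= al * dot x u.
    rewrite ler_pM2l // (le_trans _ uA) // ler_wpM2r // ltW //.
  by move: h; lra.
have : lambda_min S * dot w w <= al * dot w w / tau.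
  apply: (le_trans Sw); rewrite sE gerDr.
  by rewrite pmulr_rle0.
rewrite ler_pdivlMr // mulrAC ler_pM2r // mulrC => h.
by move: al_lt; rewrite ltNge h.
Qed.

(* The hypotheses say that [M v = (al + i be) v] for [v = (rx + i sx, rw + i sw)].
   Pairing with [v] blockwise, [be != 0] forces [a = 2 al X] and
   [tau g = (al^2 + be^2) X], where [a], [g], [X] are the values of [x^* A x],
   [|G x|^2], [|x|^2] at [x = rx + i sx]; but [4 tau g X <= a^2] by the bound on
   [tau]. *)
Lemma saddle_eigenvalue_imag0 (al be : R) (rx sx : 'cV[R]_n) (rw sw : 'cV[R]_q) :
  0 < dot rx rx + dot sx sx ->
  A *m rx + G^T *m rw = al *: rx - be *: sx ->
  - tau *: (G *m rx) = al *: rw - be *: sw ->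
  A *m sx + G^T *m sw = be *: rx + al *: sx ->
  - tau *: (G *m sx) = be *: rw + al *: sw ->
  be = 0.
Proof.
move=> X0 e1 e2 e3 e4; apply/eqP; apply: contraT => be0.
have gE x w : dot x (G^T *m w) = dot w (G *m x) by rewrite dot_mulmx trmxK dotC.
have As x y : dot x (A *m y) = dot y (A *m x).
  by rewrite dot_mulmx posdefmx_sym dotC.
have E1r := congr1 (dot rx) e1; have E1s := congr1 (dot sx) e1.
have E3r := congr1 (dot rx) e3; have E3s := congr1 (dot sx) e3.
have E2r := congr1 (dot rw) e2; have E2s := congr1 (dot sw) e2.
have E4r := congr1 (dot rw) e4; have E4s := congr1 (dot sw) e4.
have E5 := congr1 (fun z => dot z z) e2; have E6 := congr1 (fun z => dot z z) e4.
rewrite !dotE ?gE in E1r E1s E2r E2s E3r E3s E4r E4s E5 E6.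
rewrite (As sx rx) (dotC sx rx) (dotC sw rw) in E1s E3s E4s E4r E2s E5 E6.
have := dot_mulmx_le_schur rx; have := dot_mulmx_le_schur sx.
have /andP[aA1 _] := rayleigh_dot rx posdefmx_sym.
have /andP[aA2 _] := rayleigh_dot sx posdefmx_sym.
have tS := tau_schur_le; have L0 := lambda_max_schur_gt0.
have a1 := posdefmx_dot_ge0 rx; have a2 := posdefmx_dot_ge0 sx.
pose X := dot rx rx + dot sx sx; pose W := dot rw rw + dot sw sw.
pose a := dot rx (A *m rx) + dot sx (A *m sx).
pose g := dot (G *m rx) (G *m rx) + dot (G *m sx) (G *m sx).
move=> g2 g1; have gL : g <= lambda_max S * a by rewrite /g /a; lra.
have aX : lambda_min A * X <= a by rewrite /X /a; lra.
(* Real part of the blockwise pairing, the first block weighted by [tau] so that the terms in [G]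
   cancel. *)
have aW : tau * a = al * (tau * X + W).
  apply/eqP; rewrite -subr_eq0; apply/eqP.
  transitivity (tau * (dot rx (A *m rx) + dot rw (G *m rx))
      + tau * (dot sx (A *m sx) + dot sw (G *m sx))
      + (- tau * dot rw (G *m rx)) + (- tau * dot sw (G *m sx))
      - al * (tau * X + W) ); first by rewrite /a; ring.
  by rewrite E1r E3s E2r E4s /X /W; ring.
(* Imaginary part of the pairing: symmetry of [A] cancels its terms, and what remains has the factor
   [be]. *)
have WX : W = tau * X.
  apply: (mulfI be0).
  have : tau * ((dot rx (A *m sx) + dot rw (G *m sx))
        - (dot rx (A *m sx) + dot sw (G *m rx)))
      = - tau * dot sw (G *m rx) - - tau * dot rw (G *m sx) by ring.
  by rewrite E1s E3r E2s E4r /X /W; lra.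
(* Squared norms of the two sides of the second block row. *)
have gW : tau ^+ 2 * g = (al ^+ 2 + be ^+ 2) * W.
  transitivity (- tau * (- tau * dot (G *m rx) (G *m rx))
    + - tau * (- tau * dot (G *m sx) (G *m sx))); first by rewrite /g; ring.
  by rewrite E5 E6 /W; ring.
have {aW} aE : a = 2 * al * X.
  by apply: (mulfI (lt0r_neq0 tau_gt0)); rewrite aW WX; ring.
have {gW} gE' : tau * g = (al ^+ 2 + be ^+ 2) * X.
  by apply: (mulfI (lt0r_neq0 tau_gt0)); rewrite mulrA -expr2 gW WX; ring.
have a0 : 0 <= a by rewrite addr_ge0.
have h1 : 4 * (tau * g) * X <= a * a.
  apply: (@le_trans _ _ (lambda_min A * X * a)); last by rewrite ler_wpM2r.
  rewrite [leRHS]mulrAC ler_wpM2r ?(ltW X0) //.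
  apply: (@le_trans _ _ (4 * tau * (lambda_max S * a))).
    by rewrite -mulrA !ler_wpM2l // ltW.
  by rewrite mulrA ler_wpM2r.
(* Now [4 (al^2 + be^2) X^2 <= 4 al^2 X^2], which forces [be X = 0]. *)
move: h1; rewrite gE' aE => h1.
have : 0 < (be * X) ^+ 2 by rewrite exprn_even_gt0 //= mulf_neq0 // gt_eqF.
by move: h1; lra.
Qed.

End SaddlePoint.

(** * Rational Z-transforms *)

Lemma cvgn_dist_lt (K : numFieldType) (f : nat -> K) (l e : K) :
  f @ \oo --> l -> 0 < e -> \forall n \near \oo, `|l - f n| < e.
Proof. by move=> /cvgrPdist_lt; apply. Qed.

Section ZTransform.
Context {R : realType}.
Local Notation toC := (real_complex R).

(** As the sum is zero, the first term [u N * t ^- N] is balanced by the tail, which is dominated by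
    a geometric series of ratio [t0 / t <= 1 / 2]. *)
Lemma laurent_series_leading_bound (u : nat -> R) (B t0 t : R) N :
  0 < t0 -> 2 * t0 <= t -> (forall j, `|u j| <= B * t0 ^+ j) ->
  (forall j, (j < N)%N -> u j = 0) ->
  series (fun k => u k * t ^- k) @ \oo --> (0 : R) ->
  `|u N| * t <= 2 * B * t0 ^+ N.+1.
Proof.
move=> t00 t0t uB uN ser0.
have t_gt0 : 0 < t by apply: lt_le_trans t0t; rewrite mulr_gt0.
have B0 : 0 <= B by have := uB 0; rewrite expr0 mulr1; apply: le_trans.
pose x := t0 / t; have x0 : 0 <= x by rewrite divr_ge0 // ltW.
have x2 : x <= 2^-1 by rewrite ler_pdivrMr // mulrC ler_pdivlMr // mulrC.
have termB j : `|u j * t ^- j| <= B * x ^+ j.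
  rewrite normrM normfV (ger0_norm (exprn_ge0 _ (ltW t_gt0))) expr_div_n mulrA.
  by rewrite ler_pM2r // invr_gt0 exprn_gt0.
(* The last factor is the partial sum of [k] terms of the geometric series of ratio [1 / 2]. *)
have partialB k : `|series (fun k => u k * t ^- k) (N.+1 + k)%N - u N * t ^- N|
    <= B * x ^+ N.+1 * (2 - 2 * 2^-1 ^+ k).
  elim: k => [|k IH].
    rewrite addn0 expr0 mulr1 subrr mulr0 /series /= big_nat_recr //= big_nat big1.
      by rewrite add0r subrr normr0.
    by move=> i /andP[_ iN]; rewrite uN // mul0r.
  rewrite addnS /series /= big_nat_recr //= addrAC.
  apply: (le_trans (ler_normD _ _)).
  apply: (@le_trans _ _
    (B * x ^+ N.+1 * (2 - 2 * 2^-1 ^+ k) + B * x ^+ N.+1 * 2^-1 ^+ k)).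
    apply: lerD => //; apply: (le_trans (termB _)); rewrite exprD mulrA.
    by rewrite ler_wpM2l ?mulr_ge0 ?exprn_ge0 ?lerXn2r ?nnegrE ?invr_ge0.
  by rewrite [2^-1 ^+ k.+1]exprSr; move: (B * x ^+ N.+1) (2^-1 ^+ k) => U V; lra.
have limB : `|u N * t ^- N| <= 2 * B * x ^+ N.+1.
  rewrite leNgt; apply/negP => lt_c.
  have /cvgrPdist_lt := ser0 => /(_ (`|u N * t ^- N| - 2 * B * x ^+ N.+1)) [].
    by rewrite subr_gt0.
  move=> M _ /(_ (N.+1 + M)%N (leq_addl _ _)); rewrite sub0r normrN.
  have := partialB M; have : 0 <= B * x ^+ N.+1 * (2 * 2^-1 ^+ M).
    by rewrite !mulr_ge0 ?exprn_ge0.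
  rewrite distrC; set S := series _ _; have := lerB_dist (u N * t ^- N) S; lra.
have tN : 0 < t ^+ N by rewrite exprn_gt0.
move: limB; rewrite normrM normfV (gtr0_norm tN) ler_pdivrMr // expr_div_n.
suff -> : 2 * B * (t0 ^+ N.+1 / t ^+ N.+1) * t ^+ N = 2 * B * t0 ^+ N.+1 / t.
  by rewrite ler_pdivlMr.
by rewrite [t ^+ N.+1]exprS; field; rewrite !gt_eqF.
Qed.

(** Convergence at one point [t0] bounds the coefficients geometrically. The first nonzero
    coefficient would then satisfy the leading bound for all large [t], whose right side does not
    depend on [t]. *)
Lemma laurent_series_eq0 (u : nat -> R) (r : R) :
  (forall t, r < t -> series (fun k => u k * t ^- k) @ \oo --> (0 : R)) ->
  forall k, u k = 0.
Proof.
move=> ser0; pose t0 := Num.max r 0 + 1.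
have t00 : 0 < t0 by rewrite ltr_wpDl // le_max lexx orbT.
have rt0 : r < t0 by rewrite ltr_pwDr // le_max lexx.
have [B uB] : exists B, forall j, `|u j| <= B * t0 ^+ j.
  have := cvg_series_cvg_0 (cvgP _ (ser0 _ rt0)).
  move=> /cvgP/cvg_seq_bounded/pinfty_ex_gt0[B _ /= uB].
  exists B => j; have := uB j I.
  rewrite normrM normfV (gtr0_norm (exprn_gt0 _ t00)) ler_pdivrMr //.
  exact: exprn_gt0.
elim/ltn_ind => N IH; apply/eqP; apply: contraT; rewrite -normr_gt0 => uN.
(* This [t] makes [|u N| t] at least [C + 1], while the leading bound gives at most [C]. *)
pose C := 2 * B * t0 ^+ N.+1; pose t := Num.max (2 * t0) ((C + 1) / `|u N|).
have tt0 : 2 * t0 <= t by rewrite le_max lexx.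
have rt : r < t by apply: (lt_le_trans rt0); apply: (le_trans _ tt0); lra.
have := laurent_series_leading_bound t00 tt0 uB IH (ser0 _ rt).
have : (C + 1) / `|u N| <= t by rewrite le_max lexx orbT.
by rewrite ler_pdivrMr // -/C mulrC; lra.
Qed.

(** Expansions in powers of [1 / t] are unique, and a polynomial has no negative powers. *)
Lemma laurent_series_polynomial (v : nat -> R) (Q : {poly R}) (r : R) :
  (forall t, r < t -> series (fun k => v k * t ^- k) @ \oo --> Q.[t]) ->
  forall k, v k.+1 = 0.
Proof.
move=> serQ k; pose D := size Q.
(* [u j] is the coefficient of [t ^- j] in [t ^- D * (\sum_k v k * t ^- k - Q.[t])]. *)
pose u j := (if (j < D)%N then 0 else v (j - D)%N)
  - (if (j <= D)%N then Q`_(D - j) else 0).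
(* Beyond index [D] only [v] contributes to [u]; at [D] the constant coefficient of [Q] still
   enters, so [v 0] is excluded. *)
suff : u (D + k.+1)%N = 0.
  by rewrite /u ltnNge leq_addr /= addKn addnS leqNgt ltnS leq_addr /= subr0.
apply: (@laurent_series_eq0 u (Num.max r 0)) => t.
rewrite gt_max => /andP[rt t_gt0].
have main : (fun n => t ^- D * (series (fun k => v k * t ^- k) n.+1 - Q.[t])) @ \oo
    --> (0 : R).
  rewrite -(mulr0 (t ^- D)); apply: cvgMr; rewrite -(subrr Q.[t]).
  apply: cvgB; last exact: cvg_cst.
  by have := serQ t rt; rewrite -(cvg_shiftS (series _)).
(* With the offset [D.+1] each partial sum of [u] already contains all of [Q]. *)
rewrite -(cvg_shiftn D.+1).
have -> : (fun n => series (fun k => u k * t ^- k) (n + D.+1)%N) =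
    (fun n => t ^- D * (series (fun k => v k * t ^- k) n.+1 - Q.[t])).
  apply/funext => n; rewrite /series /=.
  under eq_bigr => j _ do rewrite mulrBl.
  rewrite sumrB mulrBr; congr (_ - _).
    rewrite [(n + D.+1)%N]addnC addSnnS !big_mkord big_split_ord /= big1 ?add0r; last first.
      by move=> i _; rewrite ltn_ord mul0r.
    rewrite mulr_sumr; apply: eq_bigr => i _.
    by rewrite ltnNge leq_addr /= addKn exprD invfM mulrCA.
  rewrite [(n + D.+1)%N]addnC big_mkord big_split_ord /= [X in _ + X]big1 ?addr0; last first.
    by move=> i _; rewrite leqNgt ltnS leq_addr mul0r.
  rewrite (reindex_inj rev_ord_inj) /= (horner_coef_wide _ (leqnSn (size Q))).
  rewrite mulr_sumr; apply: eq_bigr => i _; rewrite subSS leq_subr.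
  have iD : (i <= D)%N by rewrite -ltnS.
  rewrite subKn // mulrCA; congr (_ * _).
  by rewrite -[in RHS](subnK iD) exprD invfM mulfVK // expf_neq0 // gt_eqF.
exact: main.
Qed.

(** The shift rule of the transform: a shift by [i] multiplies by [t ^+ i] after removal of the
    first [i] terms. *)
Lemma series_shift_act (p : {poly R}) (s : nat -> R) (t L : R) : t != 0 ->
  series (fun k => s k * t ^- k) @ \oo --> L ->
  series (fun k => shift_act p s k * t ^- k) @ \oo -->
    \sum_(i < size p) p`_i * (t ^+ i * L - \sum_(j < i) s j * t ^+ (i - j)).
Proof.
move=> t0 serL.
have -> : series (fun k => shift_act p s k * t ^- k) = (fun n =>
    \sum_(i < size p) p`_i * (t ^+ i * series (fun k => s k * t ^- k) (n + i)%N
      - \sum_(j < i) s j * t ^+ (i - j))).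
  apply/funext => n; rewrite /series /= /shift_act.
  under eq_bigr => k _ do rewrite mulr_suml.
  rewrite exchange_big; apply: eq_bigr => i _ /=.
  under eq_bigr => k _ do rewrite -mulrA.
  rewrite -mulr_sumr; congr (_ * _).
  rewrite [in RHS]addnC [in RHS]big_mkord big_split_ord /= mulrDr.
  have -> : t ^+ i * \sum_(j < i) s j * t ^- j = \sum_(j < i) s j * t ^+ (i - j).
    rewrite mulr_sumr; apply: eq_bigr => j _; rewrite mulrCA; congr (_ * _).
    rewrite -{1}(subnK (ltnW (ltn_ord j))) exprD mulfK // expf_neq0 //.
  rewrite addrAC subrr add0r mulr_sumr big_mkord; apply: eq_bigr => k _.
  by rewrite [(k + i)%N]addnC mulrCA exprD invfM mulVKf // expf_neq0.
apply: cvg_big => [|i _]; first exact: add_continuous.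
apply: cvgMr; apply: cvgB; last exact: cvg_cst.
by apply: cvgMr; rewrite (cvg_shiftn i (series _)).
Qed.

(** Real points suffice to identify coefficients, so the uniqueness argument can stay over [R]. *)
Lemma real_ztransform (s : nat -> R) (num den : {poly R}) :
  has_ztransform (fun k => toC (s k)) (ratfun num den) ->
  exists r : R, forall t, r < t ->
    series (fun k => s k * t ^- k) @ \oo --> num.[t] / den.[t].
Proof.
case=> -[r r'] /=; rewrite ltcE /= => /andP[/eqP r'0 r0] ser.
exists r => t rt; have t0 : 0 < t := lt_trans r0 rt.
have rtC : Complex r r' < `|toC t|.
  by rewrite norm_complexE ltcE /= r'0 eqxx expr0n /= addr0 sqrtr_sqr gtr0_norm.
apply/cvgrPdist_lt => e e0.
have eC : 0 < toC e by rewrite ltcR.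
have := cvgn_dist_lt (ser _ rtC) eC.
apply: filterS => n.
have -> : series (fun k => toC (s k) * toC t ^- k) n =
    toC (series (fun k => s k * t ^- k) n).
  rewrite /series /= rmorph_sum; apply: eq_bigr => k _.
  by rewrite rmorphM fmorphV rmorphXn.
rewrite /ratfun !horner_map -fmorph_div -rmorphB norm_complexE ltcR.
by rewrite /= expr0n addr0 sqrtr_sqr.
Qed.

(** By the shift rule, [p(sigma) s] has the polynomial transform [Q], namely [num] minus boundary
    terms. The constant term of [Q], which is that of [num], gives the value at index 0; hence the
    [k.+1]. *)
Lemma ztransform_recurrence (s : nat -> R) (num p : {poly R}) :
  (forall z : R[i], root (map_poly toC p) z -> `|z| = 1) ->
  has_ztransform (fun k => toC (s k)) (ratfun num p) ->
  forall k, shift_act p s k.+1 = 0.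
Proof.
move=> p1 /real_ztransform[r ser].
pose Q := num - \sum_(i < size p) p`_i *: \sum_(j < i) s j *: 'X^(i - j).
(* Beyond 1 the denominator does not vanish, since its roots have modulus 1. *)
apply: (@laurent_series_polynomial _ Q (Num.max r 1)) => t.
rewrite gt_max => /andP[rt t1]; have t0 : 0 < t := lt_trans ltr01 t1.
have pt : p.[t] != 0.
  apply/eqP => pt; have : root (map_poly toC p) (toC t).
    by rewrite /root horner_map pt rmorph0.
  move=> /p1 /eqP; rewrite norm_complexE /= expr0n addr0 sqrtr_sqr gtr0_norm //.
  by move=> /eqP[te]; move: t1; rewrite te ltxx.
have := @series_shift_act p s t _ (lt0r_neq0 t0) (ser t rt).
suff -> : \sum_(i < size p) p`_i * (t ^+ i * (num.[t] / p.[t])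
    - \sum_(j < i) s j * t ^+ (i - j)) = Q.[t] by [].
rewrite /Q hornerD hornerN horner_sum.
under eq_bigr => i _ do rewrite mulrBr mulrA.
rewrite sumrB -mulr_suml -horner_coef mulrC divfK //; congr (_ - _).
apply: eq_bigr => i _; rewrite hornerZ horner_sum; congr (_ * _).
by apply: eq_bigr => j _; rewrite hornerZ hornerXn.
Qed.

End ZTransform.

(** * The closed loop *)

Section ClosedLoop.
Context {R : realType}.
Local Notation toC := (real_complex R).

Lemma char_poly_companion_F m (r : {poly R}) : r \is monic -> size r = m.+1 ->
  char_poly (companion_F m r) = r.
Proof.
move=> rm sr; have -> : m = (size r).-1 by rewrite sr.
exact: companionmxK.
Qed.

(** The rank-one term changes only the last row, so [F + lam C K] is again a companion matrix; the
    degree bound on [c] keeps [p - lam *: c] monic of degree [m]. *)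
Lemma char_poly_companion_Fc m (p c : {poly R}) lam :
  (0 < m)%N -> p \is monic -> size p = m.+1 -> (size c <= m)%N ->
  char_poly (companion_Fc m p c lam) = p - lam *: c.
Proof.
move=> m_gt0 pm sp sc.
have sZ : (size (- (lam *: c)) < size p)%N.
  by rewrite size_polyN sp ltnS (leq_trans (size_scale_leq _ _)).
have -> : companion_Fc m p c lam = companion_F m (p - lam *: c).
  apply/matrixP => i j; rewrite !mxE big_ord1 !mxE !coefE.
  by case: eqP => _; rewrite ?mul1r ?mul0r ?mulr0 ?addr0 // opprB addrC.
apply: char_poly_companion_F; last by rewrite size_polyDl.
by rewrite monicE lead_coefDl // -monicE.
Qed.

Lemma complex_ReD (x y : R[i]) : complex.Re (x + y) = complex.Re x + complex.Re y.
Proof. by case: x y => [a b] []. Qed.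

Lemma complex_ImD (x y : R[i]) : complex.Im (x + y) = complex.Im x + complex.Im y.
Proof. by case: x y => [a b] []. Qed.

Lemma map_Re_mulmx a b (M : 'M[R]_(a, b)) (u : 'cV[R[i]]_b) :
  map_mx (@complex.Re R) (map_mx toC M *m u) = M *m map_mx (@complex.Re R) u.
Proof.
apply/colP => i; rewrite !mxE (big_morph _ complex_ReD (id1 := 0)) //.
by apply: eq_bigr => j _; rewrite !mxE; case: (u j 0) => x y /=; rewrite mul0r subr0.
Qed.

Lemma map_Im_mulmx a b (M : 'M[R]_(a, b)) (u : 'cV[R[i]]_b) :
  map_mx (@complex.Im R) (map_mx toC M *m u) = M *m map_mx (@complex.Im R) u.
Proof.
apply/colP => i; rewrite !mxE (big_morph _ complex_ImD (id1 := 0)) //.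
by apply: eq_bigr => j _; rewrite !mxE; case: (u j 0) => x y /=; rewrite mul0r addr0.
Qed.

Definition saddle_mx n q (A : 'M[R]_n) (G : 'M[R]_(q, n)) (tau : R) : 'M[R]_(n + q) :=
  block_mx A G^T (- tau *: G) 0.

Definition closed_loop_mx N (p c : {poly R}) (M : 'M[R]_N) : 'M[{poly R}]_N :=
  p%:M - c *: map_mx polyC M.

Lemma closed_loop_det_root N (p c : {poly R}) (M : 'M[R]_N) (z : R[i]) :
  root (map_poly toC (\det (closed_loop_mx p c M))) z ->
  exists2 u : 'cV[R[i]]_N, u != 0 &
    (map_poly toC p).[z] *: u = (map_poly toC c).[z] *: (map_mx toC M *m u).
Proof.
rewrite /root -det_map_mx -horner_evalE -det_map_mx -det_tr => /det0P[v v0 vP].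
exists v^T; first by rewrite -(inj_eq (@trmx_inj _ _ _)) trmxK trmx0.
move/(congr1 trmx): vP; rewrite trmx_mul trmxK trmx0.
have -> : map_mx (horner_eval z) (map_mx (map_poly toC) (closed_loop_mx p c M)) =
    (map_poly toC p).[z]%:M - (map_poly toC c).[z] *: map_mx toC M.
  apply/matrixP => i j; rewrite !mxE /= /horner_eval.
  rewrite raddfB /= rmorphM /= rmorphMn /= map_polyC hornerE hornerMn.
  by rewrite hornerN hornerM hornerC.
by rewrite mulmxBl mul_scalar_mx -scalemxAl => /eqP; rewrite subr_eq0 => /eqP.
Qed.

Lemma saddle_mx_eigenvalue n q (A : 'M[R]_n) (G : 'M[R]_(q, n)) (tau : R)
    (mu : R[i]) (u : 'cV[R[i]]_(n + q)) :
  (0 < n)%N -> (0 < q)%N -> posdefmx A -> row_free G -> 0 < tau ->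
  tau <= lambda_min A / (4 * lambda_max (G *m invmx A *m G^T)) ->
  u != 0 -> map_mx toC (saddle_mx A G tau) *m u = mu *: u ->
  exists2 lam, mu = toC lam &
    tau * lambda_min (G *m invmx A *m G^T) <= lam <= lambda_max A.
Proof.
move=> n0 q0 Apos Gfree tau0 tau_le u0 Mu.
pose r := map_mx (@complex.Re R) u; pose s := map_mx (@complex.Im R) u.
case: mu Mu => al be Mu.
have Mr : saddle_mx A G tau *m r = al *: r - be *: s.
  rewrite -map_Re_mulmx Mu; apply/colP => i; rewrite !mxE.
  by case: (u i 0).
have Ms : saddle_mx A G tau *m s = be *: r + al *: s.
  rewrite -map_Im_mulmx Mu; apply/colP => i; rewrite !mxE.
  by case: (u i 0) => x y /=; rewrite addrC.
rewrite -[r]vsubmxK -[s]vsubmxK in Mr Ms.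
set rx := usubmx r in Mr Ms; set rw := dsubmx r in Mr Ms.
set sx := usubmx s in Mr Ms; set sw := dsubmx s in Mr Ms.
move: Mr Ms; rewrite /saddle_mx !mul_block_col !mul0mx !addr0 -!scalemxAl.
rewrite !scale_col_mx opp_col_mx !add_col_mx.
move=> /eq_col_mx[e1 e2] /eq_col_mx[e3 e4].
(* If the primal block vanishes, the first row leaves [G^T w = 0], hence [w = 0] by full row
   rank. *)
have X0 : (rx != 0) || (sx != 0).
  rewrite -negb_and; apply: contra u0 => /andP[/eqP rx0 /eqP sx0].
  move: e1 e3; rewrite rx0 sx0 !mulmx0 !scaler0 subrr !add0r.
  move=> /(trmx_free_inj Gfree) rw0 /(trmx_free_inj Gfree) sw0.
  have r0 : r = 0 by rewrite -[r]vsubmxK -/rx -/rw rx0 rw0 col_mx0.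
  have s0 : s = 0 by rewrite -[s]vsubmxK -/sx -/sw sx0 sw0 col_mx0.
  apply/eqP/colP => i; have /colP/(_ i) := r0; have /colP/(_ i) := s0.
  by rewrite !mxE; case: (u i 0) => x y /= -> ->.
have be0 : be = 0.
  apply: (saddle_eigenvalue_imag0 q0 Apos Gfree tau0 tau_le _ e1 e2 e3 e4).
  by case/orP: X0 => h; [rewrite ltr_wpDr|rewrite ltr_wpDl]; rewrite ?dot_ge0 ?dot_gt0.
move: e1 e2 e3 e4; rewrite be0 !scale0r !subr0 !add0r => e1 e2 e3 e4.
(* With [be = 0], the real and imaginary parts of [u] satisfy the same real equations; one with
   nonzero primal block is used. *)
exists al => //.
by case/orP: X0 => h; [apply: saddle_real_eigenvalue_bounds h e1 e2
                     |apply: saddle_real_eigenvalue_bounds h e3 e4].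
Qed.

Lemma closed_loop_stable n q m (A : 'M[R]_n) (G : 'M[R]_(q, n)) (tau : R)
    (p c : {poly R}) (z : R[i]) :
  (0 < n)%N -> (0 < q)%N -> (0 < m)%N -> posdefmx A -> row_free G -> 0 < tau ->
  tau <= lambda_min A / (4 * lambda_max (G *m invmx A *m G^T)) ->
  p \is monic -> size p = m.+1 -> (size c <= m)%N ->
  (forall lam : R,
      tau * lambda_min (G *m invmx A *m G^T) <= lam <= lambda_max A ->
      schur_stable (companion_Fc m p c lam)) ->
  root (map_poly toC (\det (closed_loop_mx p c (saddle_mx A G tau)))) z -> `|z| < 1.
Proof.
move=> n0 q0 m0 Apos Gfree tau0 tau_le pm sp sc stable.
have stable_root lam : tau * lambda_min (G *m invmx A *m G^T) <= lam <= lambda_max A ->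
    (map_poly toC p).[z] = toC lam * (map_poly toC c).[z] -> `|z| < 1.
  move=> /stable lamP pz; apply: lamP.
  rewrite eigenvalue_root_char -map_char_poly char_poly_companion_Fc //.
  by rewrite /root raddfB /= map_polyZ !hornerE pz subrr.
move=> /closed_loop_det_root[u u0 pcu].
(* If [c] vanishes at [z], so does [p], and any [lam] in the interval serves; otherwise the ratio of
   [p] to [c] at [z] is an eigenvalue of the saddle matrix. *)
have [cz|cz] := eqVneq (map_poly toC c).[z] 0.
  apply: (stable_root (lambda_max A)).
    by rewrite lexx andbT; exact: tau_interval_nonempty.
  move/eqP: pcu; rewrite cz scale0r scaler_eq0 (negPf u0) orbF => /eqP ->.
  by rewrite mulr0.
have [|lam muE lamP] := @saddle_mx_eigenvalue n q A G tau
  ((map_poly toC p).[z] / (map_poly toC c).[z]) u n0 q0 Apos Gfree tau0 tau_le u0.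
  apply: (scalerI cz); rewrite -pcu scalerA mulrCA mulfV ?mulr1 //.
by apply: (stable_root lam lamP); rewrite -muE divfK.
Qed.

End ClosedLoop.

(** * The algorithm *)

Section Realization.
Context {R : realType} {m d : nat}.

Lemma sum_mxtens_index (f : 'I_(m * d) -> R) :
  \sum_k f k = \sum_(i < m) \sum_(a < d) f (mxtens_index (i, a)).
Proof.
rewrite pair_big /= (reindex (@mxtens_index m d)) /=; last first.
  by exists (@mxtens_unindex m d) => ? _; rewrite ?mxtens_indexK ?mxtens_unindexK.
by apply: eq_bigr => -[].
Qed.

Lemma sum_mulr_delta (I : finType) (f : I -> R) (a : I) :
  \sum_b f b * (a == b)%:R = f a.
Proof.
rewrite (bigD1 a) //= eqxx mulr1 big1 ?addr0 // => b ba.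
by rewrite eq_sym (negPf ba) mulr0.
Qed.

(** The index [(i, a)] is component [a] of block [i]; the identity factor yields [d] independent
    copies of the scalar system. *)
Lemma F_kronE (p : {poly R}) (z : 'cV[R]_(m * d)) (i : 'I_m) (a : 'I_d) :
  (F_kron m d p *m z) (mxtens_index (i, a)) 0 =
    \sum_(j < m) companion_F m p i j * z (mxtens_index (j, a)) 0.
Proof.
rewrite mxE sum_mxtens_index; apply: eq_bigr => j _.
under eq_bigr => b _ do rewrite tensmxE [1%:M a b]mxE mulrAC.
exact: (sum_mulr_delta (fun b => companion_F m p i j * z (mxtens_index (j, b)) 0)).
Qed.

Lemma mxtens_index0 (a : 'I_d) :
  cast_ord (esym (mul1n d)) a = mxtens_index (ord0 : 'I_1, a).
Proof. by apply: val_inj. Qed.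

Lemma C_kronE (e : 'cV[R]_d) (i : 'I_m) (a : 'I_d) :
  (C_kron m d *m e) (mxtens_index (i, a)) 0 = (i == m.-1 :> nat)%:R * e a 0.
Proof.
rewrite mxE -[RHS](sum_mulr_delta (fun b => (i == m.-1 :> nat)%:R * e b 0)).
apply: eq_bigr => b _; rewrite castmxE /= cast_ord_id mxtens_index0 tensmxE !mxE.
by rewrite mulrAC.
Qed.

Lemma K_kronE (c : {poly R}) (z : 'cV[R]_(m * d)) (a : 'I_d) :
  (K_kron m d c *m z) a 0 = \sum_(j < m) c`_j * z (mxtens_index (j, a)) 0.
Proof.
rewrite mxE sum_mxtens_index; apply: eq_bigr => j _.
rewrite -[RHS](sum_mulr_delta (fun b => c`_j * z (mxtens_index (j, b)) 0)).
apply: eq_bigr => b _; rewrite castmxE /= cast_ord_id mxtens_index0 tensmxE !mxE.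
by rewrite mulrAC.
Qed.

End Realization.

(** In each component, with [zeta] the first block, the last row of [F] gives [p(sigma) zeta = e]
    and the output is [c(sigma) zeta]; the two operators commute. *)
Lemma companion_realization (R : realType) (m d : nat) (p c : {poly R})
    (z : nat -> 'cV[R]_(m * d)) (e : nat -> 'cV[R]_d) :
  (0 < m)%N -> p \is monic -> size p = m.+1 -> (size c <= m)%N ->
  (forall k, z k.+1 = F_kron m d p *m z k + C_kron m d *m e k) ->
  forall a k, shift_act p (fun k => (K_kron m d c *m z k) a 0) k =
    shift_act c (fun k => e k a 0) k.
Proof.
case: m z => // m z _ pm sp sc zS a k.
(* Block [i] of the state is the [i]-th shift of block [0]. *)
pose zeta k := z k (mxtens_index (ord0, a)) 0.
have zE i k' : (i < m.+1)%N -> z k' (mxtens_index (inord i, a)) 0 = zeta (k' + i)%N.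
  elim: i k' => [|i IH] k' im.
    rewrite addn0 /zeta; congr (z k' (mxtens_index (_, a)) 0).
    by apply: val_inj; rewrite /= inordK.
  rewrite addnS -addSn -IH; last exact: ltnW.
  rewrite zS mxE F_kronE C_kronE inordK ?(ltnW im) // ltn_eqF // mul0r addr0.
  rewrite (bigD1 (inord i.+1)) //= mxE !inordK ?(ltnW im) // ltn_eqF // eqxx mul1r.
  rewrite big1 ?addr0 // => j ji; rewrite mxE inordK ?(ltnW im) // ltn_eqF //.
  suff -> : (i.+1 == j) = false by rewrite mul0r.
  by apply: contraNF ji => /eqP ij; apply/eqP/val_inj; rewrite /= inordK.
have zE' (i : 'I_m.+1) k' : z k' (mxtens_index (i, a)) 0 = zeta (k' + i)%N.
  by rewrite -zE // inord_val.
have pzeta k' : shift_act p zeta k' = e k' a 0.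
  rewrite /shift_act sp big_ord_recr /=.
  have -> : p`_m.+1 = 1 by move: pm; rewrite monicE lead_coefE sp => /eqP.
  rewrite mul1r addnS -addSn -[m in zeta (_ + m)%N]/(val (@ord_max m)) -zE'.
  rewrite zS mxE F_kronE C_kronE /= eqxx mul1r addrA -[RHS]add0r; congr (_ + _).
  rewrite -big_split big1 //= => j _; rewrite mxE eqxx zE'; ring.
rewrite -(eq_shift_act _ (s := shift_act c zeta)); last first.
  move=> j _; rewrite K_kronE (shift_act_wide _ _ sc).
  by apply: eq_bigr => i _; rewrite zE'.
by rewrite shift_actMC; apply: eq_shift_act => j _.
Qed.

(** * Optimality conditions *)

Section KKT.
Context {R : realType} {n q : nat}.
Variables (A : 'M[R]_n) (G : 'M[R]_(q, n)).
Variables (b : nat -> 'cV[R]_n) (h : nat -> 'cV[R]_q).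
Hypotheses (Apos : posdefmx A) (Gfree : row_free G).

Let S := G *m invmx A *m G^T.

(** Block elimination: inserting [A x = - (b + G^T w)] into [G x = h] gives
    [S w = - (h + G A^-1 b)]. *)
Definition kkt_dual k : 'cV[R]_q := - (invmx S *m (h k + G *m invmx A *m b k)).
Definition kkt_primal k : 'cV[R]_n := - (invmx A *m (b k + G^T *m kkt_dual k)).

Lemma kkt_stationary k : grad_x A b G k (kkt_primal k) (kkt_dual k) = 0.
Proof.
rewrite /grad_x {1}/kkt_primal mulmxN mulKVmx ?posdefmx_unit //.
by rewrite -addrA addNr.
Qed.

Lemma schur_unit : S \in unitmx.
Proof.
apply: posdefmx_unit; split; first exact: schur_sym.
by move=> w w0; rewrite -mulmxA; exact: schur_posdef.
Qed.

Lemma kkt_feasible k : G *m kkt_primal k = h k.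
Proof.
rewrite /kkt_primal mulmxN mulmxDr mulmxDr !mulmxA -/S opprD.
rewrite {1}/kkt_dual mulmxN mulKVmx ?schur_unit // opprK.
by rewrite addrC -addrA subrr addr0.
Qed.

(* [kkt_primal k] is feasible and the linear term of the Lagrangian vanishes
   there, so optimality of [x] makes [A] nonpositive at [x - kkt_primal k]. *)
Lemma argmin_kkt k x : is_argmin A b G h k x -> x = kkt_primal k.
Proof.
move=> [Gx /(_ _ (kkt_feasible k)) xmin].
pose y := kkt_primal k; pose w := kkt_dual k; pose dx := x - y.
have := lagrangianDx b G h k y w dx (posdefmx_sym Apos).
rewrite kkt_stationary trmx0 mul0mx mxE addr0 addrC subrK /lagrangian Gx.
rewrite kkt_feasible subrr mulmx0 mxE !addr0 => qE.
apply/eqP; rewrite -subr_eq0; apply: contraT => dx0.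
have := posdefmx_dot Apos dx0; rewrite /dot mulmxA -/y -/dx => dx_gt0.
by move: xmin; rewrite qE -/y; lra.
Qed.

End KKT.

(** * Recurrences for vector sequences *)

Section VectorRecurrences.
Context {R : realType}.

Lemma shift_act_mulmx m n (B : 'M[R]_(m, n)) (s : nat -> 'cV[R]_n) p i k :
  shift_act p (fun t => (B *m s t) i 0) k =
    \sum_j B i j * shift_act p (fun t => s t j 0) k.
Proof.
by rewrite -shift_act_linr; apply: eq_shift_act => t _; rewrite mxE.
Qed.

(** Constant matrices commute with the shift, and the KKT pair is linear in [b] and [h]. *)
Lemma kkt_recurrence n q (A : 'M[R]_n) (G : 'M[R]_(q, n))
    (b : nat -> 'cV[R]_n) (h : nat -> 'cV[R]_q) (p : {poly R}) :
  (forall i k, shift_act p (fun t => b t i 0) k.+1 = 0) ->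
  (forall i k, shift_act p (fun t => h t i 0) k.+1 = 0) ->
  (forall i k, shift_act p (fun t => kkt_primal A G b h t i 0) k.+1 = 0) /\
  (forall i k, shift_act p (fun t => kkt_dual A G b h t i 0) k.+1 = 0).
Proof.
have mul0 a r (B : 'M[R]_(a, r)) (s : nat -> 'cV[R]_r) :
  (forall i k, shift_act p (fun t => s t i 0) k.+1 = 0) ->
  forall i k, shift_act p (fun t => (B *m s t) i 0) k.+1 = 0.
  by move=> s0 i k; rewrite shift_act_mulmx big1 // => j _; rewrite s0 mulr0.
have add0 a (s t : nat -> 'cV[R]_a) :
  (forall i k, shift_act p (fun j => s j i 0) k.+1 = 0) ->
  (forall i k, shift_act p (fun j => t j i 0) k.+1 = 0) ->
  forall i k, shift_act p (fun j => (s j + t j) i 0) k.+1 = 0.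
  move=> s0 t0 i k; rewrite (eq_shift_act _ (t := fun j => s j i 0 + t j i 0)).
    by rewrite shift_actDr s0 t0 addr0.
  by move=> j _; rewrite mxE.
have opp0 a (s : nat -> 'cV[R]_a) :
  (forall i k, shift_act p (fun j => s j i 0) k.+1 = 0) ->
  forall i k, shift_act p (fun j => (- s j) i 0) k.+1 = 0.
  move=> s0 i k; rewrite (eq_shift_act _ (t := fun j => - s j i 0)).
    by rewrite shift_actNr s0 oppr0.
  by move=> j _; rewrite mxE.
move=> b0 h0; have dual0 : forall i k,
    shift_act p (fun t => kkt_dual A G b h t i 0) k.+1 = 0.
  by apply/opp0/mul0/add0 => //; apply: mul0.
by split=> //; apply/opp0/mul0/add0 => //; apply: mul0.
Qed.

Lemma closed_loop_recurrence N (p c : {poly R}) (M : 'M[R]_N) (v : nat -> 'cV[R]_N) :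
  (forall i k, shift_act p (fun t => v t i 0) k =
     shift_act c (fun t => (M *m v t) i 0) k) ->
  forall i k, shift_act (\det (closed_loop_mx p c M)) (fun t => v t i 0) k = 0.
Proof.
move=> vP; apply: (shift_act_det (v := fun i t => v t i 0)) => i k.
under eq_bigr => j _.
  rewrite !mxE mulrC mul_polyC -scaleNr shift_actD shift_actZ mulNr.
  over.
rewrite sumrB -shift_act_mulmx -vP (bigD1 i) //= eqxx mulr1n big1 ?addr0 ?subrr //.
by move=> j ji; rewrite eq_sym (negPf ji) mulr0n shift_act0.
Qed.

Lemma limn_esup_enorm0 n (x : nat -> 'cV[R]_n) :
  (forall i, (fun k => x k i 0) @ \oo --> (0 : R)) ->
  limn_esup (fun k => (enorm (x k))%:E) = 0%E.
Proof.
move=> x0; apply: (cvg_limn_einf_sup _).2; apply: cvg_EFin; first exact: nearW.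
have sq0 : (fun k => \sum_i x k i 0 ^+ 2) @ \oo --> (0 : R).
  suff : (fun k => \sum_i x k i 0 ^+ 2) @ \oo --> \sum_(i < n) (0 : R) by rewrite big1.
  apply: cvg_big => [|i _]; first exact: add_continuous.
  have -> : (fun k => x k i 0 ^+ 2) = (fun k => x k i 0) \* (fun k => x k i 0).
    by apply/funext => k; rewrite expr2.
  by rewrite -[X in _ --> X](mulr0 (0 : R)); exact: cvgM (x0 i) (x0 i).
have := cvg_comp _ _ sq0 (@sqrt_continuous R 0).
by rewrite sqrtr0.
Qed.

End VectorRecurrences.

(** * Convergence of the tracking error *)

Theorem proposition10 (R : realType) (n q m : nat)
    (A : 'M[R]_n) (G : 'M[R]_(q, n))
    (b : nat -> 'cV[R]_n) (h : nat -> 'cV[R]_q)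
    (p c : {poly R}) (bN : 'cV[{poly R}]_n) (hN : 'cV[{poly R}]_q)
    (xstar : nat -> 'cV[R]_n) (tau : R)
    (z0 : 'cV[R]_(m * n)) (y0 : 'cV[R]_(m * q)) :
  (0 < n)%N -> (0 < q)%N -> (0 < m)%N ->
  posdefmx A ->
  row_free G ->
  p \is monic -> size p = m.+1 ->
  (forall z : R[i], root (map_poly (real_complex R) p) z -> `|z| = 1) ->
  has_rational_ztransform b bN p ->
  has_rational_ztransform h hN p ->
  (forall k, is_argmin A b G h k (xstar k)) ->
  0 < tau ->
  tau <= lambda_min A / (4 * lambda_max (G *m invmx A *m G^T)) ->
  (size c <= m)%N ->
  (forall lam : R,
      tau * lambda_min (G *m invmx A *m G^T) <= lam <= lambda_max A ->
      schur_stable (companion_Fc m p c lam)) ->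
  limn_esup (fun k =>
    (enorm (alg_output p c tau A b G h z0 y0 k - xstar k))%:E) = 0%E.
Proof.
move=> n0 q0 m0 Apos Gfree pm sp p1 bZ hZ xstarP tau0 tau_le sc stable.
have [xs0 ws0] := kkt_recurrence A G (fun i => ztransform_recurrence p1 (bZ i))
  (fun i => ztransform_recurrence p1 (hZ i)).
pose xs := kkt_primal A G b h; pose ws := kkt_dual A G b h.
pose st := alg_state p c tau A b G h z0 y0.
pose x k := primal c (st k).1; pose w k := dual c tau (st k).2.
pose e k := grad_x A b G k (x k) (w k); pose f k := grad_w G h k (x k) (w k).
have zS k : (st k.+1).1 = F_kron m n p *m (st k).1 + C_kron m n *m e k.
  by rewrite /e /x /w /st /=; case: alg_state.
have yS k : (st k.+1).2 = F_kron m q p *m (st k).2 + C_kron m q *m f k.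
  by rewrite /f /x /w /st /=; case: alg_state.
have xP := companion_realization m0 pm sp sc zS.
have yP := companion_realization m0 pm sp sc yS.
pose v k := col_mx (x k - xs k) (w k - ws k).
(* Subtracting stationarity and feasibility of the KKT pair cancels [b k] and [h k]. *)
have Mv k : saddle_mx A G tau *m v k = col_mx (e k) (- tau *: f k).
  rewrite mul_block_col mul0mx addr0 -scalemxAl !mulmxBr kkt_feasible //; congr col_mx.
  have /eqP := kkt_stationary G b h Apos k.
  rewrite /e /grad_x -/xs -/ws addr_eq0 addrC => /eqP bE.
  by rewrite -[b k](addrK (A *m xs k)) bE [- _ - _]addrC !addrA [RHS]addrAC.
(* The error is shifted by one because [p(sigma)] annihilates the KKT pair only from index 1 on. *)
have vP i k : shift_act p (fun t => v t.+1 i 0) k =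
    shift_act c (fun t => (saddle_mx A G tau *m v t.+1) i 0) k.
  rewrite (shift_act_succ p (fun t => v t i 0)).
  rewrite (shift_act_succ c (fun t => (saddle_mx A G tau *m v t) i 0)).
  case: (split_ordP i) => a ->.
    transitivity (shift_act p (fun t => x t a 0 + - xs t a 0) k.+1).
      by apply: eq_shift_act => t _; rewrite col_mxEu !mxE.
    rewrite shift_actDr shift_actNr xs0 subr0 xP.
    by apply: eq_shift_act => t _; rewrite Mv col_mxEu.
  transitivity (shift_act p (fun t => w t a 0 + - ws t a 0) k.+1).
    by apply: eq_shift_act => t _; rewrite col_mxEd !mxE.
  rewrite shift_actDr shift_actNr ws0 subr0.
  transitivity (shift_act c (fun t => - tau * f t a 0) k.+1); last first.
    by apply: eq_shift_act => t _; rewrite Mv col_mxEd [RHS]mxE.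
  rewrite shift_actZr -yP -shift_actZr.
  by apply: eq_shift_act => t _; rewrite mxE.
apply: limn_esup_enorm0 => a.
have stableD := closed_loop_stable n0 q0 m0 Apos Gfree tau0 tau_le pm sp sc stable.
have vD := closed_loop_recurrence (v := fun t => v t.+1) vP (lshift q a).
have := cvg0_stable_recurrence stableD vD.
have -> : (fun k => v k.+1 (lshift q a) 0) =
    (fun k => (alg_output p c tau A b G h z0 y0 k.+1 - xstar k.+1) a 0).
  by apply/funext => k; rewrite col_mxEu (argmin_kkt Apos Gfree (xstarP k.+1)).
(* The omitted initial term does not affect the limit. *)
by rewrite (cvg_shiftS (fun k => (alg_output p c tau A b G h z0 y0 k - xstar k) a 0)).
Qed.
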